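(* Let $\sigma>0$ and let $\vec\alpha=(\alpha_n)_{n\ge0}$, $\vec\beta=(\beta_n)_{n\ge0}$ be sequences of non-negative reals, neither identically zero, such that $$\sum_{n=0}^\infty n\alpha_n<\infty\quad\text{and}\quad \sum_{n=0}^\infty n\beta_n<\infty.$$ For each $L\ge1$ let $(\gamma^{(L)}_0,\dots,\gamma^{(L)}_L)$ be a random Motzkin path of length $L$ sampled from $\Pr_L$ (defined in the context), and define the processes $\{\gamma^{(L)}_k\}_{k\ge0}$ and $\{\widetilde\gamma^{(L)}_k\}_{k\ge0}$ by $\gamma^{(L)}_k:=0$ for $k>L$, and $\widetilde\gamma^{(L)}_k:=\gamma^{(L)}_{L-k}$ for $0\le k\le L$, $\widetilde\gamma^{(L)}_k:=0$ for $k>L$. Then, as $L\to\infty$, $$\Big(\{\gamma^{(L)}_k\}_{k\ge0},\{\widetilde\gamma^{(L)}_k\}_{k\ge0}\Big)\Rightarrow\Big(\{X_k\}_{k\ge0},\{X'_k\}_{k\ge0}\Big)$$ in the sense of convergence of finite-dimensional distributions, where $\{X_k\}$ and $\{X'_k\}$ are two independent Markov chains on $\mathbb Z_{\ge0}$ with the same transition probabilities $$\mathsf P_{n,m}=\begin{cases}\frac{1}{2+\sigma}\frac{n+2}{n+1}, & m=n+1,\\ \frac{\sigma}{2+\sigma}, & m=n,\\ \frac{1}{2+\sigma}\frac{n}{n+1}, & m=n-1\ge0,\\ 0, &\text{otherwise},\end{cases}\qquad n\ge0,$$ and initial laws $$\Pr(X_0=n)=\frac{(n+1)\alpha_n}{C_{\vec\alpha}},\qquad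 \Pr(X'_0=n)=\frac{(n+1)\beta_n}{C_{\vec\beta}},\quad n\ge0,$$ with $C_{\vec\alpha}=\sum_{m\ge0}(m+1)\alpha_m$ and $C_{\vec\beta}=\sum_{m\ge0}(m+1)\beta_m$.
   Context: A Motzkin path of length $L\in\mathbb Z_{\ge1}$ is a sequence $\vec\gamma=(\gamma_0,\gamma_1,\dots,\gamma_L)$ of non-negative integers with $|\gamma_k-\gamma_{k-1}|\le1$ for $k=1,\dots,L$; $\mathcal M^{(L)}$ denotes the set of all such paths (with arbitrary end points). Given $\sigma>0$, the weight of a path is $w(\vec\gamma)=\sigma^{\#\{k\in\{1,\dots,L\}:\ \gamma_k=\gamma_{k-1}\}}$ (up steps and down steps have weight $1$, horizontal steps weight $\sigma$). Given non-negative sequences $\vec\alpha,\vec\beta$, set $\mathfrak C_{\vec\alpha,\vec\beta,L}=\sum_{\vec\gamma\in\mathcal M^{(L)}}\alpha_{\gamma_0}\beta_{\gamma_L}w(\vec\gamma)$; when this is finite and positive, $\Pr_L(\vec\gamma)=\alpha_{\gamma_0}\beta_{\gamma_L}w(\vec\gamma)/\mathfrak C_{\vec\alpha,\vec\beta,L}$ is a probability measure on $\mathcal M^{(L)}$. *)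

(* Defs.v *)
From HB Require Import structures.
From mathcomp Require Import all_boot all_order all_algebra.
From mathcomp Require Import all_classical all_reals all_analysis.
Unset Printing Implicit Defensive.
Import Order.TTheory GRing.Theory Num.Theory.
Local Open Scope classical_set_scope.
Local Open Scope ring_scope.

Section motzkin.
Context {R : realType}.

Definition path_t (L : nat) := {ffun 'I_L.+1 -> nat}.

Definition pval (L : nat) (g : path_t L) (k : nat) : nat :=
  if (k <= L)%N then g (inord k) else 0%N.

Definition rpval (L : nat) (g : path_t L) (k : nat) : nat :=
  if (k <= L)%N then g (inord (L - k)) else 0%N.

Definition motzkin (L : nat) : set (path_t L) :=
  [set g | forall k : nat, (k < L)%N ->
     (pval L g k.+1 <= (pval L g k).+1)%N /\ (pval L g k <= (pval L g k.+1).+1)%N].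

Definition nflat (L : nat) (g : path_t L) : nat :=
  (\sum_(k < L) (pval L g k == pval L g k.+1))%N.

Definition pweight (sigma : R) (alpha beta : nat -> R) (L : nat) (g : path_t L) : R :=
  alpha (pval L g 0) * beta (pval L g L) * sigma ^+ nflat L g.

Definition Cnorm (sigma : R) (alpha beta : nat -> R) (L : nat) : \bar R :=
  \esum_(g in motzkin L) (pweight sigma alpha beta L g)%:E.

Definition PrL (sigma : R) (alpha beta : nat -> R) (L : nat) (E : set (path_t L)) : R :=
  fine (\esum_(g in motzkin L `&` E) (pweight sigma alpha beta L g)%:E)
  / fine (Cnorm sigma alpha beta L).

Definition trans (sigma : R) (n m : nat) : R :=
  if m == n.+1 then (2 + sigma)^-1 * ((n.+2)%:R / (n.+1)%:R)
  else if m == n then sigma / (2 + sigma)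
  else if m.+1 == n then (2 + sigma)^-1 * (n%:R / (n.+1)%:R)
  else 0.

Definition init_law (alpha : nat -> R) (n : nat) : R :=
  (n.+1)%:R * alpha n / fine (\sum_(m <oo) ((m.+1)%:R * alpha m)%:E)%E.

(* finite-dimensional law of a Markov chain with initial law mu and
   transition matrix P: Pr(X_0 = a_0, ..., X_K = a_K) *)
Definition mc_fdd (mu : nat -> R) (P : nat -> nat -> R) (K : nat) (a : nat -> nat) : R :=
  mu (a 0%N) * \prod_(k < K) P (a k) (a k.+1).

End motzkin.

(* Main.v *)
(* Write w L n m (below, tm) for the total weight of the length-L paths from n to m,
   i.e. the entries of the powers of T = A + sigma, where A is the adjacency matrix of
   the half-line.  Since w L n m / w L 0 0 tends to (n+1)(m+1) and
   w (L+1) 0 0 / w L 0 0 tends to rho = 2 + sigma, a cylinder event, which cuts a path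
   into two fixed ends and a free middle part, has in the limit the product of the two
   Markov weights.

   The limits come without spectral theory.  As T commutes with A, w L satisfies the
   discrete wave equation
     w L (n+1) m + w L (n-1) m = w L n (m+1) + w L n (m-1),
   hence w L n n - w L (n+1) (n-1) = w L 0 0.  For even L, w L is a Gram matrix and A has
   norm at most 2, so this reads (t_n - t_(n-1))^2 <= t_0^2 with t_n = sqrt (w L n n); thus
   t_n <= (n+1) t_0 and w L n m <= (n+1)(m+1) w L 0 0.  Together with the harmonic function
   n+1, for the eigenvalue rho of T, this bounds w L 0 0 below by rho^L up to a polynomial
   factor, so the log-convex sequence w (2L) 0 0 has ratio limit rho^2.  Its ratio is
   sigma^2 + 2 sigma u + v with u = w (2L) 0 1 / w (2L) 0 0 <= 2 and
   v = w (2L) 1 1 / w (2L) 0 0 <= 4, which forces u -> 2 and the ratio limit rho along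
   all L; the wave equation propagates it to all n, m.  The same bound, valid for
   all L up to a constant, dominates the sums over the end points. *)
Require Import Defs.
From HB Require Import structures.
From mathcomp Require Import all_boot all_order all_algebra.
From mathcomp Require Import all_classical all_reals all_analysis.
From mathcomp Require Import ring lra zify.
Import Order.TTheory GRing.Theory Num.Theory numFieldNormedType.Exports.
Local Open Scope classical_set_scope.
Local Open Scope ring_scope.

(** * Powers of the transfer matrix: symmetry and exact identities *)

Section transfer.
Context {R : comNzRingType} (sigma : R).

Definition adj (f : nat -> R) (m : nat) : R :=
  f m.+1 + (if m is k.+1 then f k else 0).

(* [tm L n m] is the total weight of the paths of length [L] from [n] to [m]. *)
Fixpoint tm (L n m : nat) : R :=
  if L is L'.+1 then adj (tm L' n) m + sigma * tm L' n m else (n == m)%:R.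

(** On the left [A] acts on the starting point, on the right on the end point; both agree because
    [T] is a polynomial in [A]. *)
Lemma tm_wave L n m :
  tm L n.+1 m + (if n is k.+1 then tm L k m else 0) = adj (tm L n) m.
Proof.
elim: L m => [|L IH] m.
  by rewrite /adj; case: n m => [|n] [|m]; rewrite /= ?eqSS ?addr0 ?add0r//= addrC.
have hs : sigma * tm L n.+1 m =
    sigma * adj (tm L n) m - sigma * (if n is k.+1 then tm L k m else 0).
  by rewrite -IH; case: (n) => *; ring.
rewrite /= {}hs [RHS]/adj -(IH m.+1).
by case: m => [|m]; rewrite -?(IH m) /adj; case: n {IH} => [|n] /=; ring.
Qed.

Lemma tm_sym L n m : tm L n m = tm L m n.
Proof.
elim: L n m => [|L IH] n m /=; first by rewrite eq_sym.
rewrite -tm_wave /adj IH (IH n m); case: n => [|n]; by rewrite // (IH n m).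
Qed.

Lemma tm_small L n m : (n + L < m)%N -> tm L n m = 0.
Proof.
elim: L m => [|L IH] m h /=; first by case: eqP => //; lia.
rewrite /adj !IH; [|lia|lia]; case: m h => [|m] h; first by rewrite mulr0 !addr0.
by rewrite IH ?mulr0 ?addr0//; lia.
Qed.

Lemma sum_adj (f g : nat -> R) N : f N = 0 -> g N = 0 ->
  \sum_(k < N) adj f k * g k = \sum_(k < N) f k * adj g k.
Proof.
(* Without the vanishing hypotheses each side keeps a boundary term; the induction runs on that
   form. *)
suff H M : \sum_(k < M.+1) adj f k * g k + f M * g M.+1 =
    \sum_(k < M.+1) f k * adj g k + f M.+1 * g M.
  case: N => [|M] f0 g0; first by rewrite !big_ord0.
  by have := H M; rewrite f0 g0 mulr0 mul0r !addr0.
elim: M => [|M IH]; first by rewrite !big_ord1 /adj /=; ring.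
rewrite big_ord_recr [in RHS]big_ord_recr /= /adj.
move/(canRL (addrK _)): IH => ->; case: (M) => *; ring.
Qed.

(** Each induction step moves one factor [T] across the sum, [A] being self-adjoint. Both rows
    vanish from [N] on, so the truncation is harmless. *)
Lemma sum_tm_mul L L' n m N : (n + m + L + L' < N)%N ->
  \sum_(k < N) tm L n k * tm L' m k = tm (L + L') n m.
Proof.
elim: L L' => [|L IH] L' h.
  have nN : (n < N)%N by lia.
  rewrite (bigD1 (Ordinal nN)) //= eqxx mul1r big1 ?addr0 ?add0n; first exact: tm_sym.
  by move=> i /eqP ni; case: eqP => [ei|_]; rewrite ?mul0r//; case: ni; apply/val_inj.
rewrite addSnnS -IH; last by lia.
under eq_bigr do rewrite /= mulrDl.
under [RHS]eq_bigr do rewrite /= mulrDr.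
rewrite !big_split/= sum_adj ?tm_small//; [|lia|lia].
by congr (_ + _); apply: eq_bigr => i _; ring.
Qed.

(** By the wave equation the difference of the two entries does not change along the diagonal;
    column 0 fixes its value. *)
Lemma tm_diag L n : tm L n.+1 n.+1 = tm L n.+2 n + tm L 0 0.
Proof.
elim: n => [|n IH].
  by have := tm_wave L 1 0; rewrite /adj /= addr0 => <-.
have := tm_wave L n.+2 n.+1; rewrite /= /adj IH => h.
by move/(canRL (addrK _)): h => ->; ring.
Qed.

(** The function [k + 1] vanishes at -1, where the half-line is cut, and so is an eigenfunction of
    [T] for [2 + sigma]. *)
Lemma tm_sum_harmonic L N : (L < N)%N ->
  \sum_(k < N) tm L 0 k * k.+1%:R = (2 + sigma) ^+ L.
Proof.
move=> LN.
(* The cutoff provides the zero at [N] that [sum_adj] asks for. *)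
pose h N k : R := if (k < N)%N then k.+1%:R else 0.
elim: L LN => [|L IH] LN.
  case: N LN => // N _; rewrite big_ord_recl /= big1 ?addr0 ?mul1r ?expr0//.
  by move=> i _; rewrite /= mul0r.
rewrite exprS -IH; last by lia.
have -> : \sum_(k < N) tm L.+1 0 k * k.+1%:R =
  \sum_(k < N) (adj (tm L 0) k + sigma * tm L 0 k) * h N k.
  by apply: eq_bigr => i _; rewrite /h ltn_ord.
under eq_bigr do rewrite mulrDl.
rewrite big_split/= sum_adj; last 2 first.
- by rewrite tm_small//; lia.
- by rewrite /h ltnn.
rewrite -big_split/= mulr_sumr; apply: eq_bigr => -[k kN] _ /=.
rewrite {2}/h kN.
(* The cutoff spoils the eigenvalue equation only at the last site, which paths of length [L] from 0
   do not reach. *)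
have [e|ne] := eqVneq k N.-1.
  by rewrite !(@tm_small L 0 k) ?mul0r ?mulr0 ?mul0r ?addr0//; lia.
rewrite /adj /h; have -> : (k.+1 < N)%N by move/eqP: ne; lia.
case: k kN ne => [|k] kN ne; first by ring.
by have -> : (k < N)%N; [lia | ring].
Qed.

End transfer.

(** * Gram-matrix bounds and growth of the return weights *)

Section estimates.
Context {R : rcfType}.

Lemma sum_mul_le_sqrt (a b : nat -> R) N :
  \sum_(k < N) a k * b k <=
  Num.sqrt (\sum_(k < N) a k ^+ 2) * Num.sqrt (\sum_(k < N) b k ^+ 2).
Proof.
elim: N => [|N IH]; first by rewrite !big_ord0 sqrtr0 mul0r.
rewrite !big_ord_recr /=.
set A := \sum_(_ < N) a _ ^+ 2 in IH *; set B := \sum_(_ < N) b _ ^+ 2 in IH *.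
have A0 : 0 <= A by apply: sumr_ge0 => i _; exact: sqr_ge0.
have B0 : 0 <= B by apply: sumr_ge0 => i _; exact: sqr_ge0.
apply: le_trans (lerD IH (lexx _)) _.
rewrite -(sqrtrM (B + b N ^+ 2)); last by rewrite addr_ge0 ?sqr_ge0.
apply: le_trans (ler_norm _) _; rewrite -sqrtr_sqr; apply: ler_wsqrtr.
rewrite -{2}(sqr_sqrtr A0) -{2}(sqr_sqrtr B0).
move: (Num.sqrt A) (Num.sqrt B) (a N) (b N) => x y c d.
(* Lagrange's identity in dimension two. *)
rewrite -subr_ge0; have -> : (x ^+ 2 + c ^+ 2) * (y ^+ 2 + d ^+ 2) -
  (x * y + c * d) ^+ 2 = (x * d - y * c) ^+ 2 by ring.
exact: sqr_ge0.
Qed.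

(** [A] is a shift plus its transpose, and the shift does not increase the norm; hence the factor
    2. *)
Lemma sum_adj_le_sqrt (f g : nat -> R) N : f N = 0 -> g N = 0 ->
  \sum_(k < N) adj f k * g k <=
  2 * (Num.sqrt (\sum_(k < N) f k ^+ 2) * Num.sqrt (\sum_(k < N) g k ^+ 2)).
Proof.
move=> f0 g0.
have S (h : nat -> R) : h N = 0 ->
    \sum_(k < N) h k.+1 ^+ 2 <= \sum_(k < N) h k ^+ 2.
  move=> h0; have -> : \sum_(k < N) h k ^+ 2 = \sum_(k < N.+1) h k ^+ 2.
    by rewrite big_ord_recr /= h0 expr0n addr0.
  by rewrite big_ord_recl lerDr sqr_ge0.
have H (h k : nat -> R) : h N = 0 -> \sum_(i < N) h i.+1 * k i <=
    Num.sqrt (\sum_(k < N) h k ^+ 2) * Num.sqrt (\sum_(i < N) k i ^+ 2).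
  move=> h0; apply: le_trans (sum_mul_le_sqrt (fun i => h i.+1) k N) _.
  by rewrite ler_wpM2r ?sqrtr_ge0// ler_wsqrtr// S.
have -> : \sum_(k < N) adj f k * g k =
    \sum_(k < N) f k.+1 * g k + \sum_(k < N) g k.+1 * f k.
  rewrite /adj; under eq_bigr do rewrite mulrDl.
  rewrite big_split; congr (_ + _); case: N f0 g0 {S H} => [|N] f0 g0.
    by rewrite !big_ord0.
  rewrite big_ord_recl big_ord_recr /= mul0r add0r g0 mul0r addr0.
  by apply: eq_bigr => i _; rewrite mulrC.
by rewrite mulr2n mulrDl !mul1r lerD ?H// mulrC H.
Qed.

Context (sigma : R).
Hypothesis sigma0 : 0 < sigma.
Local Notation tm := (tm sigma).
Local Notation d L := (tm L 0 0).

Lemma tm_ge0 L n m : 0 <= tm L n m.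
Proof.
elim: L m => [|L IH] m; first exact: ler0n.
rewrite /= /adj; have := IH m; have := IH m.+1; case: m => [|m]; last have := IH m;
by move=> *; rewrite !addr_ge0// mulr_ge0// ltW.
Qed.

Lemma tm_flat L : sigma * d L <= d L.+1.
Proof. by rewrite /= /adj addr0 lerDr tm_ge0. Qed.

Lemma tm00_gt0 L : 0 < d L.
Proof.
elim: L => [|L IH]; first by rewrite /= ltr01.
by apply: lt_le_trans (tm_flat _); rewrite mulr_gt0.
Qed.

(** Expands [<T e0, T^L T e0>] with [T e0 = sigma e0 + e1]. *)
Lemma tm_SS00 L : d L.+2 = sigma ^+ 2 * d L + 2 * sigma * tm L 0 1 + tm L 1 1.
Proof.
have := tm_wave sigma L 0 1; rewrite /= /adj /= addr0 => ->.
by rewrite !addr0; ring.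
Qed.

Lemma sqrt_sum_tm L n N : (2 * n + 2 * L < N)%N ->
  Num.sqrt (\sum_(k < N) tm L n k ^+ 2) = Num.sqrt (tm (L + L) n n).
Proof.
move=> h; congr Num.sqrt; rewrite -(sum_tm_mul sigma L L n n N) //; lia.
Qed.

Lemma tm_even_CauchySchwarz L n m :
  tm (L + L) n m <= Num.sqrt (tm (L + L) n n) * Num.sqrt (tm (L + L) m m).
Proof.
pose N := (2 * n + 2 * m + 2 * L).+1.
rewrite -(@sqrt_sum_tm L n N) -?(@sqrt_sum_tm L m N); [|rewrite /N; lia..].
rewrite -(sum_tm_mul sigma L L n m N); last by rewrite /N; lia.
exact: sum_mul_le_sqrt.
Qed.

(** Rows [n + 1] and [n] of [T^L] are paired through [A]: the wave equation and [tm_diag] evaluate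
    the pairing, [sum_adj_le_sqrt] bounds it. *)
Lemma sqrt_tm_diag_step L n : Num.sqrt (tm (L + L) n.+1 n.+1) <=
  Num.sqrt (tm (L + L) n n) + Num.sqrt (d (L + L)).
Proof.
pose N := (2 * n + 2 * L).+4.+1.
have := sum_adj_le_sqrt (tm L n.+1) (tm L n) N.
rewrite (@tm_small _ _ L n.+1 N) ?(@tm_small _ _ L n N); [|rewrite /N; lia..].
move=> /(_ erefl erefl).
under eq_bigr do rewrite -tm_wave mulrDl.
rewrite !sqrt_sum_tm; [|rewrite /N; lia..].
rewrite big_split/= !sum_tm_mul; [|rewrite /N; lia..].
have -> : tm (L + L) n.+2 n = tm (L + L) n.+1 n.+1 - d (L + L).
  by rewrite tm_diag addrK.
have := sqr_sqrtr (tm_ge0 (L + L) n n).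
have := sqr_sqrtr (tm_ge0 (L + L) n.+1 n.+1).
have := sqr_sqrtr (tm_ge0 (L + L) 0 0).
have := sqrtr_ge0 (d (L + L)).
move: (Num.sqrt _) (Num.sqrt (tm _ n.+1 _)) (Num.sqrt (tm _ n _)) => z x y z0.
(* Here [h] reads [x^2 - z^2 + y^2 <= 2xy], that is, [(x - y)^2 <= z^2]. *)
move=> <- <- <- h; rewrite -lerBlDl; apply: le_trans (ler_norm _) _.
rewrite -(ler_pXn2r (_ : 0 < 2)%N) ?nnegrE// real_normK ?num_real//; nra.
Qed.

Lemma sqrt_tm_diag_le L n :
  Num.sqrt (tm (L + L) n n) <= n.+1%:R * Num.sqrt (d (L + L)).
Proof.
elim: n => [|n IH]; first by rewrite mul1r.
apply: le_trans (sqrt_tm_diag_step _ _) _.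
by rewrite -natr1 mulrDl mul1r lerD.
Qed.

Lemma tm_even_le L n m : tm (L + L) n m <= n.+1%:R * m.+1%:R * d (L + L).
Proof.
apply: le_trans (tm_even_CauchySchwarz _ _ _) _.
rewrite -(sqr_sqrtr (tm_ge0 (L + L) 0 0)) expr2 mulrACA.
by rewrite ler_pM ?sqrtr_ge0 ?sqrt_tm_diag_le.
Qed.

(** For odd [L] the last step is split off: the even bounds at [m] and its neighbours add up to the
    factor [2 + sigma], and a flat step compares the two return weights at the cost [1 / sigma]. For
    even [L] the constant only has to be at least 1. *)
Lemma tm_le L n m : tm L n m <= (2 + sigma) / sigma * (n.+1%:R * m.+1%:R * d L).
Proof.
rewrite -(odd_double_half L) -addnn; move: (L./2) => M; case: (odd L); last first.
- rewrite add0n; apply: le_trans (tm_even_le _ _ _) _.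
  rewrite ler_peMl ?mulr_ge0 ?tm_ge0// ler_pdivlMr// mul1r; lra.
- rewrite add1n.
  apply: (@le_trans _ _ ((2 + sigma) * (n.+1%:R * m.+1%:R * d (M + M)))); last first.
    rewrite -[leRHS]mulrA; apply: ler_wpM2l; first by have := sigma0; lra.
    rewrite ler_pdivlMl// mulrCA ler_wpM2l ?mulr_ge0//; exact: tm_flat.
  rewrite /= /adj; have h := tm_even_le M n.
  have := h m; have := h m.+1; have := tm_ge0 (M + M) 0 0.
  have s0 := sigma0; case: m => [|m]; last have := h m.
    by rewrite -!natr1; have : (0 : R) <= n%:R by []; nra.
  rewrite -!natr1; have : (0 : R) <= n%:R by []; have : (0 : R) <= m%:R by [].
  nra.
Qed.

(** The eigenfunction identity has [2L + 1] terms, each at most [(2L + 1)^2] times the return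
    weight. *)
Lemma growth_tm00 L : (2 + sigma) ^+ (L + L) <= d (L + L) * (L + L).+1%:R ^+ 3.
Proof.
rewrite -(@tm_sum_harmonic R sigma (L + L) (L + L).+1)//.
have -> : d (L + L) * (L + L).+1%:R ^+ 3 =
  \sum_(k < (L + L).+1) d (L + L) * (L + L).+1%:R ^+ 2.
  by rewrite sumr_const card_ord -mulr_natr; ring.
apply: ler_sum => i _.
have h := tm_even_le L 0 i; rewrite mul1r in h.
have := ltn_ord i; rewrite -(ler_nat R) => hi.
apply: le_trans (ler_wpM2r _ h) _ => //.
rewrite [leLHS](_ : _ = d (L + L) * i.+1%:R ^+ 2); last by rewrite mulrAC mulrC.
by rewrite ler_wpM2l ?tm_ge0// ler_pXn2r ?nnegrE.
Qed.

Definition ratio2 L := d (L.+1 + L.+1) / d (L + L).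

Lemma ratio2_gt0 L : 0 < ratio2 L.
Proof. by rewrite divr_gt0 ?tm00_gt0. Qed.

(** Log-convexity: Cauchy-Schwarz for the rows at 0 of [T^L] and [T^(L+2)], whose inner product is
    the return weight of length [2L + 2]. *)
Lemma ratio2_nondecreasing L : ratio2 L <= ratio2 L.+1.
Proof.
have h n : 0 <= d (n + n) by exact: tm_ge0.
have C : d (L.+1 + L.+1) <= Num.sqrt (d (L + L)) * Num.sqrt (d (L.+2 + L.+2)).
  pose N := (2 * L + 5)%N.
  rewrite -(@sqrt_sum_tm L 0 N) -?(@sqrt_sum_tm L.+2 0 N); [|rewrite /N; lia..].
  rewrite (_ : L.+1 + L.+1 = L + L.+2)%N; last by lia.
  rewrite -(sum_tm_mul sigma L L.+2 0 0 N); last by rewrite /N; lia.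
  exact: sum_mul_le_sqrt.
rewrite /ratio2 ler_pdivrMr ?tm00_gt0// mulrAC ler_pdivlMr ?tm00_gt0//.
have := ler_pM (h _) (h _) C C.
by rewrite [leRHS]mulrACA -!expr2 !sqr_sqrtr// [in X in _ -> X]mulrC.
Qed.

End estimates.

(** * Ratio limits of the path weights, after two facts on real sequences *)

Lemma expr_gt_cube {R : realType} (x : R) : 0 < x ->
  exists L : nat, (L + L).+1%:R ^+ 3 < (1 + x) ^+ L.
Proof.
move=> x0.
have arch (c : R) : exists M : nat, c < M%:R.
  by exists (Num.bound `|c|); exact: le_lt_trans (ler_norm c) (archi_boundP _).
(* This [M] gives [(9M)^3 < (Mx)^4]; Bernoulli's inequality gives [(1 + x)^M >= Mx], and [L = 4M]
   has [2L + 1 <= 9M]. *)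
have [M hM] := arch (9 ^+ 3 / x ^+ 4).
have M0 : (0 : R) < M%:R by apply: lt_trans hM; rewrite divr_gt0// exprn_gt0.
have M1 : (1 : R) <= M%:R by rewrite ler1n -(ltr0n R).
exists (M * 4)%N.
have B : 1 + M%:R * x <= (1 + x) ^+ M.
  elim: (M) => [|k IH]; first by rewrite mul0r addr0 expr0.
  rewrite exprS -natr1; have : (0:R) <= k%:R by [].
  have : (1 + x) * (1 + k%:R * x) <= (1 + x) * (1 + x) ^+ k.
    by rewrite ler_wpM2l//; lra.
  nra.
have -> : (M * 4 + M * 4).+1%:R = 8 * M%:R + 1 :> R.
  by rewrite -natr1 natrD natrM; ring.
apply: (@le_lt_trans _ _ ((9 * M%:R) ^+ 3)).
  by rewrite ler_pXn2r ?nnegrE//; lra.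
apply: (@lt_le_trans _ _ ((M%:R * x) ^+ 4)); last first.
  rewrite exprM; apply: lerXn2r; rewrite ?nnegrE ?exprn_ge0 ?mulr_ge0 ?ltW//.
    by lra.
  by apply: lt_le_trans B; rewrite ltrDr.
rewrite ltr_pdivrMr ?exprn_gt0// in hM.
have -> : (M%:R * x) ^+ 4 = M%:R ^+ 3 * (M%:R * x ^+ 4) by ring.
have -> : (9 * M%:R) ^+ 3 = M%:R ^+ 3 * 9 ^+ 3 :> R by ring.
by rewrite ltr_pM2l ?exprn_gt0.
Qed.

Lemma cvg_even_odd {R : realType} (u : nat -> R) (l : R) :
  u (n + n)%N @[n --> \oo] --> l -> u (n + n).+1 @[n --> \oo] --> l ->
  u n @[n --> \oo] --> l.
Proof.
move=> /cvgrPdist_lt ce /cvgrPdist_lt co; apply/cvgrPdist_lt => e e0.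
have [N _ hN] := ce e e0; have [M _ hM] := co e e0.
exists (N + M).*2.+1 => // n /= hn.
rewrite -(odd_double_half n) -addnn; case: (boolP (odd n)) => o /=.
  by apply: hM => /=; lia.
by apply: hN => /=; lia.
Qed.

Section ratio_limits.
Context {R : realType} (sigma : R).
Hypothesis sigma0 : 0 < sigma.
Local Notation tm := (tm sigma).
Local Notation d L := (tm L 0 0).

Let d0 L : d L != 0.
Proof. by rewrite gt_eqF ?tm00_gt0. Qed.

Lemma ratio2E L : ratio2 sigma L =
  sigma ^+ 2 + 2 * sigma * (tm (L + L) 0 1 / d (L + L)) + tm (L + L) 1 1 / d (L + L).
Proof.
by rewrite /ratio2 addSn addnS tm_SS00 !mulrDl mulfK// -!mulrA.
Qed.

Lemma tm01_le L : tm (L + L) 0 1 / d (L + L) <= 2.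
Proof.
by rewrite ler_pdivrMr ?tm00_gt0//; have := tm_even_le sigma sigma0 L 0 1; rewrite mul1r.
Qed.

Lemma tm11_le L : tm (L + L) 1 1 / d (L + L) <= 4.
Proof.
rewrite ler_pdivrMr ?tm00_gt0//; have := tm_even_le sigma sigma0 L 1 1.
by rewrite -natrM.
Qed.

Lemma ratio2_le L : ratio2 sigma L <= (2 + sigma) ^+ 2.
Proof.
rewrite ratio2E; have := tm01_le L; have := tm11_le L.
by have s0 := sigma0; move: (_ / _) (_ / _) => x y; nra.
Qed.

Lemma tm00_even_le (q : R) L : (forall k, ratio2 sigma k <= q) -> d (L + L) <= q ^+ L.
Proof.
move=> hq; have q0 : 0 <= q by apply: le_trans (hq 0%N); apply/ltW/ratio2_gt0.
elim: L => [|L IH]; first by rewrite expr0.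
rewrite exprS; apply: le_trans (ler_wpM2l q0 IH).
by have := hq L; rewrite /ratio2 ler_pdivrMr ?tm00_gt0.
Qed.

(** If every ratio stayed below [q], the return weights of length [2L] would be at most [q^L],
    against [growth_tm00]. *)
Lemma ratio2_lower (e : R) : 0 < e -> exists N, (2 + sigma) ^+ 2 - e <= ratio2 sigma N.
Proof.
move=> e0; set q := _ - e; apply: contrapT => no.
have hq k : ratio2 sigma k < q by rewrite ltNge; apply/negP => h; apply: no; exists k.
have q0 : 0 < q by apply: le_lt_trans (hq 0%N); apply/ltW/ratio2_gt0.
have [L] := expr_gt_cube (e / q) (divr_gt0 e0 q0).
apply/negP; rewrite -leNgt.
have -> : 1 + e / q = (2 + sigma) ^+ 2 / q by rewrite /q; field; rewrite -/q gt_eqF.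
rewrite expr_div_n ler_pdivrMr ?exprn_gt0// -exprM mul2n -addnn.
apply: le_trans (growth_tm00 sigma sigma0 L) _; rewrite mulrC ler_wpM2l ?exprn_ge0//.
by apply: tm00_even_le => k; exact/ltW.
Qed.

Lemma cvg_ratio2 : ratio2 sigma L @[L --> \oo] --> (2 + sigma) ^+ 2.
Proof.
apply/cvgrPdist_le => e e0; have [N hN] := ratio2_lower e e0.
exists N => // L /= NL; rewrite ger0_norm ?subr_ge0 ?ratio2_le//.
suff : ratio2 sigma N <= ratio2 sigma L by move=> h; lra.
elim: L NL => [|L IH]; first by rewrite leqn0 => /eqP ->.
rewrite leq_eqVlt => /predU1P[->//|/IH h]; apply: le_trans h _.
exact: ratio2_nondecreasing.
Qed.

Lemma cvg_tm01 : tm (L + L) 0 1 / d (L + L) @[L --> \oo] --> (2 : R).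
Proof.
have s0 := sigma0.
(* The lower bound solves [ratio2E] for its first quotient, with the second replaced by its bound
   4. *)
apply: (@squeeze_cvgr _ _ _ _ (fun L => (ratio2 sigma L - sigma ^+ 2 - 4) / (2 * sigma))
  (fun=> 2)); last exact: cvg_cst.
  near=> L; rewrite tm01_le andbT ler_pdivrMr; last by lra.
  by rewrite ratio2E; have := tm11_le L; lra.
rewrite [X in _ --> X](_ : _ = ((2 + sigma) ^+ 2 - sigma ^+ 2 - 4) / (2 * sigma)).
  by apply: cvgM; [apply: cvgB; [apply: cvgB; [exact: cvg_ratio2|]|]|]; exact: cvg_cst.
by field; rewrite gt_eqF.
Unshelve. all: by end_near. Qed.

Lemma cvg_tm00_ratio : d L.+1 / d L @[L --> \oo] --> 2 + sigma.
Proof.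
have s0 := sigma0.
have E : d (L + L).+1 / d (L + L) @[L --> \oo] --> 2 + sigma.
  rewrite (_ : (fun _ => _) = fun L => tm (L + L) 0 1 / d (L + L) + sigma).
    by apply: cvgD; [exact: cvg_tm01|exact: cvg_cst].
  by apply/funext => L; rewrite /= /adj addr0 mulrDl mulfK.
apply: cvg_even_odd => //.
(* An odd ratio is [ratio2] divided by the even ratio before it. *)
rewrite (_ : (fun _ => _) =
  fun L => ratio2 sigma L * (d (L + L).+1 / d (L + L))^-1); last first.
  apply/funext => L; rewrite /ratio2 addSn addnS; field.
  by rewrite (d0 (L + L).+1) d0.
rewrite [X in _ --> X](_ : _ = (2 + sigma) ^+ 2 / (2 + sigma)).
  apply: cvgM; first exact: cvg_ratio2.
  by apply: cvgV => //; rewrite gt_eqF//; lra.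
by rewrite expr2 mulfK// gt_eqF//; lra.
Qed.

Lemma cvg_tm00_shift k : d L / d (L + k) @[L --> \oo] --> (2 + sigma) ^- k.
Proof.
have s0 := sigma0.
elim: k => [|k IH].
  rewrite expr0 invr1 (_ : (fun _ => _) = fun=> 1); first exact: cvg_cst.
  by apply/funext => L; rewrite addn0 divff.
rewrite (_ : (fun _ => _) =
  fun L => d L / d (L + k) * (d (L + k).+1 / d (L + k))^-1); last first.
  by apply/funext => L; rewrite addnS; field; rewrite !d0.
rewrite exprSr invfM; apply: cvgM => //; apply: cvgV.
  by rewrite gt_eqF//; lra.
have := cvg_tm00_ratio; rewrite -(cvg_shiftn k); exact.
Qed.

(** In the limit the recursion becomes [c_(n+1) + c_(n-1) = 2 c_n] with [c_(-1) = 0], so the limits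
    are linear in [n + 1]. *)
Lemma cvg_wave (u : nat -> nat -> R) (c : R) :
  (forall L n, u n.+1 L + (if n is k.+1 then u k L else 0) + sigma * u n L = u n L.+1) ->
  u 0%N L / d L @[L --> \oo] --> c ->
  forall n, u n L / d L @[L --> \oo] --> n.+1%:R * c.
Proof.
move=> hu h0.
suff H k : u k L / d L @[L --> \oo] --> k.+1%:R * c /\
    u k.+1 L / d L @[L --> \oo] --> k.+2%:R * c by move=> n; case: (H n).
have S n (l : R) : u n L / d L @[L --> \oo] --> l ->
    u n L.+1 / d L @[L --> \oo] --> l * (2 + sigma).
  move=> h; rewrite (_ : (fun _ => _) =
      fun L => u n L.+1 / d L.+1 * (d L.+1 / d L)); last first.
    by apply/funext => L; field; rewrite (d0 L.+1) d0.
  apply: cvgM; last exact: cvg_tm00_ratio.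
  by rewrite (cvg_shiftS (fun L => u n L / d L)).
elim: k => [|n [IH1 IH2]].
  split; first by rewrite mul1r.
  rewrite (_ : (fun _ => _) = fun L => u 0%N L.+1 / d L - sigma * (u 0%N L / d L)).
    rewrite [X in _ --> X](_ : _ = c * (2 + sigma) - sigma * c); last by ring.
    by apply: cvgB; [exact: S|by apply: cvgM => //; exact: cvg_cst].
  by apply/funext => L; rewrite -hu addr0; field; rewrite d0.
split=> //.
rewrite (_ : (fun _ => _) =
    fun L => u n.+1 L.+1 / d L - sigma * (u n.+1 L / d L) - u n L / d L).
  rewrite [X in _ --> X](_ : _ = n.+2%:R * c * (2 + sigma) - sigma * (n.+2%:R * c) -
    n.+1%:R * c); last by ring.
  by apply: cvgB => //; apply: cvgB; [exact: S|by apply: cvgM => //; exact: cvg_cst].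
by apply/funext => L; rewrite -hu; field; rewrite d0.
Qed.

Lemma cvg_tm n m : tm L n m / d L @[L --> \oo] --> (n.+1%:R * m.+1%:R : R).
Proof.
have W k L j : tm L j.+1 k + (if j is i.+1 then tm L i k else 0) + sigma * tm L j k =
    tm L.+1 j k by rewrite tm_wave.
apply: (@cvg_wave (fun n L => tm L n m)) => //.
(* By symmetry the initial value for column [m] comes from the same lemma applied to column 0. *)
rewrite -[X in _ --> X]mulr1.
rewrite (_ : (fun _ => _) = fun L => tm L m 0 / d L).
  apply: (@cvg_wave (fun n L => tm L n 0)) => //.
  rewrite (_ : (fun _ => _) = fun=> 1); first exact: cvg_cst.
  by apply/funext => L; rewrite divff.
by apply/funext => L; rewrite tm_sym.
Qed.

End ratio_limits.

(** * The transfer operator on functions, and paths with prescribed sites *)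

Section transfer_steps.
Context {R : comNzRingType} (sigma : R).

Definition transfer (y : nat -> R) (n : nat) : R := adj y n + sigma * y n.

(** An entry of [T], kept as an indicator times a power of [sigma] to match [motzkin] and
    [nflat]. *)
Definition step (n m : nat) : R :=
  ((n <= m.+1) && (m <= n.+1))%N%:R * sigma ^+ (n == m).

Lemma stepC n m : step n m = step m n.
Proof. by rewrite /step andbC eq_sym. Qed.

Lemma sum_step (y : nat -> R) n : \sum_(m < n.+2) step n m * y m = transfer y n.
Proof.
rewrite 2!big_ord_recr /= /step !leqnn leqnSn leqW// eqxx ltn_eqF//.
rewrite /transfer /adj expr1 expr0 !mul1r.
have -> : \sum_(i < n) ((n <= i.+1)%N && (i <= n.+1)%N)%:R * sigma ^+ (n == i) * y i =
    if n is k.+1 then y k else 0; last by rewrite addrC addrA.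
case: n => [|n]; first by rewrite big_ord0.
rewrite big_ord_recr /= leqnn ltnW// gtn_eqF// big1 ?mul1r ?add0r ?expr0 ?mul1r//.
by move=> i _; rewrite ltnS leqNgt ltn_ord !mul0r.
Qed.

Lemma transfer_point (y : nat -> R) n m : (forall k, k != m -> y k = 0) ->
  transfer y n = step n m * y m.
Proof.
move=> y0; rewrite -sum_step.
have [mn|nm] := ltnP m n.+2.
  rewrite (bigD1 (Ordinal mn))//= big1 ?addr0// => i im.
  by rewrite y0 ?mulr0.
rewrite /step [in RHS](leqNgt m) nm andbF !mul0r big1// => i _.
by rewrite y0 ?mulr0// ltn_eqF//; exact: leq_trans nm.
Qed.

Lemma iter_transfer L (y : nat -> R) n N : (n + L < N)%N ->
  iter L transfer y n = \sum_(m < N) tm sigma L n m * y m.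
Proof.
elim: L n => [|L IH] n h.
  have nN : (n < N)%N by lia.
  rewrite (bigD1 (Ordinal nN)) //= eqxx mul1r big1 ?addr0// => i /eqP ni.
  by case: eqP => [ei|_]; rewrite ?mul0r//; case: ni; apply/val_inj.
rewrite iterS {1}/transfer {1}/adj !IH; [|lia..].
under [RHS]eq_bigr do rewrite /= -tm_wave.
case: n h => [|n] h; rewrite ?IH; try lia.
  rewrite addr0 mulr_sumr -big_split; apply: eq_bigr => i _ /=; ring.
rewrite mulr_sumr -!big_split; apply: eq_bigr => i _ /=; ring.
Qed.

Lemma transferZ (a : R) (y : nat -> R) n : transfer (fun m => a * y m) n = a * transfer y n.
Proof. by rewrite /transfer /adj; case: n => [|n]; ring. Qed.

(* Total weight of the paths of length [L] from [n] whose [k]-th site satisfies [c k],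
   a path ending at [m] being counted with the extra factor [y m]. *)
Fixpoint constrained (L : nat) (c : nat -> pred nat) (y : nat -> R) (n : nat) : R :=
  (c 0 n)%:R *
  (if L is L'.+1 then transfer (constrained L' (c \o S) y) n else y n).

Lemma eq_transfer (y z : nat -> R) : y =1 z -> transfer y =1 transfer z.
Proof. by move=> yz n; rewrite /transfer /adj !yz; case: n => // n; rewrite yz. Qed.

Lemma constrained_free M L (c : nat -> pred nat) y : (forall k n, (k < M)%N -> c k n) ->
  constrained (M + L) c y =1 iter M transfer (constrained L (fun k => c (M + k)%N) y).
Proof.
elim: M c => [|M IH] c h n //=.
rewrite h// mul1r; apply: eq_transfer => m.
by rewrite IH// => k j kM; exact: h.
Qed.

Lemma constrained_eq0 L (c : nat -> pred nat) y n : ~~ c 0 n -> constrained L c y n = 0.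
Proof. by case: L => [|L] /= /negbTE ->; rewrite mul0r. Qed.

Lemma constrained_prefix K L (c : nat -> pred nat) y (a : nat -> nat) :
  (forall k n, (k <= K)%N -> c k n = (n == a k)) ->
  constrained (K + L) c y (a 0) =
  \prod_(k < K) step (a k) (a k.+1) * constrained L (fun k => c (K + k)%N) y (a K).
Proof.
elim: K c a => [|K IH] c a h; first by rewrite big_ord0 mul1r.
rewrite big_ord_recl /= h// eqxx mul1r (@transfer_point _ _ (a 1)); last first.
  by move=> k ka; apply: constrained_eq0; rewrite /= h.
rewrite (IH _ (a \o S)); last by move=> k n kK; rewrite /= h.
by rewrite mulrA.
Qed.

(** Sites 0 to [K] follow [a], the next [M] are free, and the last [K + 1] follow [b] read from the
    far end. Only the free stretch, of [M + 1] steps, is summed over, which leaves one entry of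
    [T^(M+1)]. *)
Lemma constrained_bridge K M (c : nat -> pred nat) y (a b : nat -> nat) :
  (forall k n, (k <= K)%N -> c k n = (n == a k)) ->
  (forall k n, (k < M)%N -> c (K + k.+1)%N n) ->
  (forall k n, (k <= K)%N -> c (K + M.+1 + k)%N n = (n == b (K - k)%N)) ->
  constrained (K + (M.+1 + K)) c y (a 0) =
  \prod_(k < K) step (a k) (a k.+1) * \prod_(k < K) step (b k) (b k.+1) *
  tm sigma M.+1 (a K) (b K) * y (b 0).
Proof.
move=> ha hf hb; rewrite constrained_prefix// -!mulrA; congr (_ * _).
rewrite addSn /= addn0 ha// eqxx mul1r.
rewrite (@eq_transfer _ (iter M transfer
    (constrained K (fun k => c (K + M.+1 + k)%N) y))); last first.
  move=> m; rewrite constrained_free; last by move=> k n kM; exact: hf.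
  by congr (iter _ _ (constrained _ _ _) _); apply/funext => k; rewrite /= -addSn addnA.
rewrite -iterS (@iter_transfer _ _ _ (a K + b K + M.+1).+1); last by lia.
have bN : (b K < (a K + b K + M.+1).+1)%N by lia.
rewrite (bigD1 (Ordinal bN))//= big1 ?addr0; last first.
  move=> i ib; rewrite constrained_eq0 ?mulr0//.
  by rewrite hb// subn0.
have := @constrained_prefix K 0 _ y (fun k => b (K - k)%N) hb.
rewrite addn0 subn0 => ->.
rewrite /= addn0 hb// subnn eqxx mul1r mulrCA; congr (_ * _).
(* The last block runs through [b] backwards; as [step] is symmetric, its product may be
   reversed. *)
rewrite (reindex_inj rev_ord_inj); apply: eq_bigr => i _ /=.
have iK := ltn_ord i.
by rewrite stepC; congr step; congr b; lia.
Qed.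

End transfer_steps.

Lemma transfer_ge0 {R : numDomainType} (sigma : R) y n : 0 <= sigma ->
  (forall n, 0 <= y n) -> 0 <= transfer sigma y n.
Proof.
by move=> s0 y0; rewrite /transfer /adj !addr_ge0 ?mulr_ge0//; case: n.
Qed.

Lemma constrained_ge0 {R : numDomainType} (sigma : R) L c y n : 0 <= sigma ->
  (forall n, 0 <= y n) -> 0 <= constrained sigma L c y n.
Proof.
move=> s0 y0; elim: L c n => [|L IH] c n; rewrite /= mulr_ge0//.
exact: transfer_ge0.
Qed.

Lemma step_ge0 {R : numDomainType} (sigma : R) n m : 0 <= sigma -> 0 <= step sigma n m.
Proof. by move=> s0; rewrite /step mulr_ge0// exprn_ge0. Qed.

(** * Sums over paths as iterated transfers *)

Section paths.
Context {R : realType}.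

Definition pcons L n (h : path_t L) : path_t L.+1 :=
  [ffun i : 'I_L.+2 => if val i is k.+1 then pval L h k else n].

Lemma pval_pcons0 L n h : pval L.+1 (pcons L n h) 0 = n.
Proof. by rewrite /pval /= ffunE /= inordK. Qed.

Lemma pval_pconsS L n h k : pval L.+1 (pcons L n h) k.+1 = pval L h k.
Proof.
rewrite /pval ltnS; case: leqP => // kL.
by rewrite ffunE /= inordK// /pval kL.
Qed.

Lemma pval_inj L (g h : path_t L) : pval L g =1 pval L h -> g = h.
Proof.
move=> gh; apply/ffunP => i; have := gh i.
by rewrite /pval -ltnS ltn_ord inord_val.
Qed.

Lemma esum_pcons L (F : path_t L.+1 -> \bar R) : (forall g, 0 <= F g)%E ->
  (\esum_(g in [set: path_t L.+1]) F g =
   \esum_(n in [set: nat]) \esum_(h in [set: path_t L]) F (pcons L n h))%E.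
Proof.
move=> F0; rewrite esum_esum//.
apply: (@reindex_esum _ _ _ _ _ (fun p => pcons L p.1 p.2)).
split=> //.
- move=> [n h] [n' h'] _ _ /= e; congr (_, _).
    by rewrite -(pval_pcons0 L n h) e pval_pcons0.
  by apply: pval_inj => k; rewrite -(pval_pconsS L n) e pval_pconsS.
- move=> g _; exists (pval L.+1 g 0, [ffun i : 'I_L.+1 => pval L.+1 g i.+1]) => //=.
  apply: pval_inj => -[|k]; first by rewrite pval_pcons0.
  rewrite pval_pconsS {1}/pval; case: leqP => [kL|Lk].
    by rewrite ffunE inordK.
  by rewrite /pval ltnS leqNgt Lk.
Qed.

Lemma esum_bounded_support (y : nat -> R) N :
  (forall m, 0 <= y m) -> (forall m, (N <= m)%N -> y m = 0) ->
  (\esum_(m in [set: nat]) (y m)%:E = (\sum_(m < N) y m)%:E)%E.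
Proof.
move=> y0 yN; rewrite -nneseries_esumT; last by move=> n; rewrite lee_fin.
rewrite (nneseries_split 0 N); last by move=> k _; rewrite lee_fin.
rewrite add0n eseries0 ?adde0; first by rewrite big_mkord sumEFin.
by move=> i Ni _; rewrite yN.
Qed.

Lemma esum_step (sigma : R) y n : 0 <= sigma -> (forall m, 0 <= y m) ->
  (\esum_(m in [set: nat]) (step sigma n m * y m)%:E = (transfer sigma y n)%:E)%E.
Proof.
move=> s0 y0; rewrite (@esum_bounded_support _ n.+2) ?sum_step//.
- by move=> m; rewrite mulr_ge0// step_ge0.
- by move=> m nm; rewrite /step [(m <= _)%N]leqNgt nm andbF !mul0r.
Qed.

Lemma motzkin_pcons L n h : motzkin L.+1 (pcons L n h) <->
  ((n <= (pval L h 0).+1) && (pval L h 0 <= n.+1))%N /\ motzkin L h.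
Proof.
split.
- move=> H; split.
    by have [] := H 0%N isT; rewrite pval_pcons0 pval_pconsS => -> ->.
  by move=> k kL; have := H k.+1 kL; rewrite !pval_pconsS.
- move=> [/andP[h1 h2] H] [|k] kL; first by rewrite pval_pcons0 pval_pconsS.
  by rewrite !pval_pconsS; exact: H.
Qed.

Lemma pweight_pcons (sigma : R) phi y L n h :
  pweight sigma phi y L.+1 (pcons L n h) =
  phi n * sigma ^+ (n == pval L h 0) * (y (pval L h L) * sigma ^+ nflat L h).
Proof.
rewrite /pweight /nflat big_ord_recl pval_pcons0 !pval_pconsS /=.
under eq_bigr do rewrite !pval_pconsS.
by rewrite exprD; ring.
Qed.

Definition admissible L (c : nat -> pred nat) : set (path_t L) :=
  [set g | motzkin L g /\ forall k, (k <= L)%N -> c k (pval L g k)].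

Lemma admissible_pcons L c n h : admissible L.+1 c (pcons L n h) <->
  [/\ c 0 n, ((n <= (pval L h 0).+1) && (pval L h 0 <= n.+1))%N & admissible L (c \o S) h].
Proof.
split.
- move=> [/motzkin_pcons[h1 h2] H]; split=> //.
    by have := H 0%N isT; rewrite pval_pcons0.
  by split=> // k kL; have := H k.+1 kL; rewrite pval_pconsS.
- move=> [c0 h1 [h2 H]]; split; first exact/motzkin_pcons.
  by move=> [|k] kL; rewrite ?pval_pcons0 ?pval_pconsS//; exact: H.
Qed.

Lemma pweight_ge0 (sigma : R) phi y L g : 0 <= sigma ->
  (forall n, 0 <= phi n) -> (forall n, 0 <= y n) -> 0 <= pweight sigma phi y L g.
Proof. by move=> s0 p0 y0; rewrite /pweight !mulr_ge0// exprn_ge0. Qed.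

(** Induction on the length, peeling off the first site; [phi] stays general because peeling changes
    it. *)
Lemma esum_admissible (sigma : R) phi y L c : 0 <= sigma ->
  (forall n, 0 <= phi n) -> (forall n, 0 <= y n) ->
  (\esum_(g in admissible L c) (pweight sigma phi y L g)%:E =
   \esum_(n in [set: nat]) (phi n * constrained sigma L c y n)%:E)%E.
Proof.
move=> s0 + y0; elim: L phi c => [|L IH] phi c p0.
  rewrite esum_mkcond (@reindex_esum _ _ _ setT _ (fun n => [ffun=> n] : path_t 0)).
    apply: eq_esum => n _; rewrite /pweight /nflat big_ord0 expr0 mulr1 /pval /= !ffunE.
    case: ifPn => [/set_mem [_ /(_ 0%N isT)]|/negP H].
      by rewrite /pval /= ffunE => ->; rewrite mul1r.
    suff -> : c 0 n = false by rewrite mul0r mulr0.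
    apply: contra_notF H => c0; apply/mem_set; split=> [k|k].
      by rewrite ltn0.
    by rewrite leqn0 => /eqP ->; rewrite /pval ffunE.
  split=> //.
    by move=> n m _ _ /ffunP/(_ ord0); rewrite !ffunE.
  move=> g _; exists (g ord0) => //; apply/ffunP => i.
  by rewrite ffunE (ord1 i).
have pw0 (psi : nat -> R) M (g : path_t M) : (forall n, 0 <= psi n) ->
    (0%:E <= (pweight sigma psi y M g)%:E)%E.
  by move=> psi0; rewrite lee_fin pweight_ge0.
rewrite esum_mkcond esum_pcons; last by move=> g; case: ifP => // _; exact: pw0.
apply: eq_esum => n _.
(* For a fixed first site [n], its weight, its constraint and the first step become the left
   boundary weight of the shorter path. *)
transitivity (\esum_(h in admissible L (c \o S))
  (pweight sigma (fun m => (c 0 n)%:R * phi n * step sigma n m) y L h)%:E)%E.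
  rewrite [RHS]esum_mkcond; apply: eq_esum => h _.
  rewrite pweight_pcons /pweight /step.
  case: ifPn => [/set_mem/admissible_pcons[-> -> H]|/negP H].
    by rewrite mem_set// !mul1r; congr EFin; ring.
  case: ifPn => // /set_mem H'; case: (boolP (c 0 n)) => [c0|_]; last by rewrite !mul0r.
  case: (boolP (_ && _)) => [h1|_]; last by rewrite !(mul0r, mulr0).
  by case: H; apply/mem_set/admissible_pcons.
rewrite IH; last by move=> m; apply: mulr_ge0; [exact: mulr_ge0|exact: step_ge0].
have C0 m : 0 <= constrained sigma L (c \o S) y m by exact: constrained_ge0.
transitivity (\esum_(m in [set: nat]) (step sigma n m *
    ((c 0 n)%:R * phi n * constrained sigma L (c \o S) y m))%:E)%E.
  by apply: eq_esum => m _; congr EFin; ring.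
rewrite esum_step//; last by move=> m; rewrite !mulr_ge0.
by rewrite transferZ /=; congr EFin; ring.
Qed.

End paths.

(** * Dominated convergence and first moments of series *)

Section series.
Context {R : realType}.

Lemma nneseries_fin_num (u g : nat -> R) : (forall n, 0 <= u n <= g n) ->
  (\sum_(n <oo) (g n)%:E < +oo)%E -> (\sum_(n <oo) (u n)%:E)%E \is a fin_num.
Proof.
move=> ug goo; rewrite ge0_fin_numE; last first.
  by apply: nneseries_ge0 => n _ _; rewrite lee_fin; case/andP: (ug n).
by apply: le_lt_trans goo; apply: lee_nneseries => [n _ _|n _];
  rewrite lee_fin; case/andP: (ug n).
Qed.

(** Lebesgue's theorem for the counting measure; domination makes every series finite, so [fine]
    loses nothing. *)
Lemma cvg_nneseries_dominated (u : nat -> nat -> R) (g l : nat -> R) :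
  (forall L n, 0 <= u L n <= g n) -> (\sum_(n <oo) (g n)%:E < +oo)%E ->
  (forall n, u L n @[L --> \oo] --> l n) ->
  fine (\sum_(n <oo) (u L n)%:E)%E @[L --> \oo] --> fine (\sum_(n <oo) (l n)%:E)%E.
Proof.
move=> ug goo ul.
have g0 n : 0 <= g n by have /andP[h] := ug 0%N n; exact: le_trans.
have lg n : 0 <= l n <= g n.
  by rewrite -(cvg_lim (@Rhausdorff R) (ul n)); apply/andP; split;
    [apply: limr_ge|apply: limr_le]; try exact: cvgP (ul n);
    apply: nearW => L; case/andP: (ug L n).
apply: fine_cvg; rewrite fineK; last exact: nneseries_fin_num lg goo.
have E (v : nat -> R) : (forall n, 0 <= v n) ->
    (\sum_(n <oo) (v n)%:E = \int[counting]_n (v n)%:E)%E.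
  by move=> v0; rewrite ge0_integral_count// => n; rewrite lee_fin.
rewrite E; last by move=> n; case/andP: (lg n).
rewrite (_ : (fun _ => _) = fun L => (\int[counting]_n (u L n)%:E)%E); last first.
  by apply/funext => L; rewrite E// => n; case/andP: (ug L n).
apply: (@dominated_cvg _ _ _ counting setT _ _ _ (fun n => (g n)%:E)) => //.
- by move=> n _; apply: cvg_EFin; [exact: nearW|exact: ul].
- apply/integrableP; split=> //.
  under eq_integral do rewrite gee0_abs ?lee_fin//.
  by rewrite -E.
- by move=> L n _; rewrite gee0_abs lee_fin; case/andP: (ug L n).
Qed.

Lemma fine_mull (c : R) (x : \bar R) : 0 < c -> fine (c%:E * x)%E = c * fine x.
Proof.
case: x => [x| |] c0; first by [].
  by rewrite gt0_muley ?lte_fin//= mulr0.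
by rewrite gt0_muleNy ?lte_fin//= mulr0.
Qed.

Definition succ_moment (y : nat -> R) : R := fine (\sum_(m <oo) ((m.+1)%:R * y m)%:E)%E.

Lemma succ_moment_lty (y : nat -> R) : (forall n, 0 <= y n) ->
  (\sum_(n <oo) (n%:R * y n)%:E < +oo)%E -> (\sum_(n <oo) (n.+1%:R * y n)%:E < +oo)%E.
Proof.
move=> y0 yoo; rewrite nneseries_recl//; last by move=> k _; rewrite lee_fin mulr_ge0.
apply: lte_add_pinfty; first exact: ltry.
(* The term at 0 is split off; from 1 on, [n + 1 <= 2n]. *)
apply: (@le_lt_trans _ _ (2%:E * \sum_(1 <= n <oo) (n%:R * y n)%:E)%E).
  rewrite -nneseriesZl; last by move=> i _; rewrite lee_fin mulr_ge0.
  rewrite [leLHS]eseries_cond [leRHS]eseries_cond.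
  apply: lee_nneseries => [i _ _|i /= i1]; rewrite lee_fin ?mulr_ge0//.
  by rewrite mulrA ler_wpM2r// -natrM ler_nat; lia.
rewrite lte_mul_pinfty// ?lee_fin//.
move: yoo; rewrite nneseries_recl//; last by move=> k _; rewrite lee_fin mulr_ge0.
by rewrite mul0r add0e.
Qed.

Lemma succ_moment_gt0 (y : nat -> R) : (forall n, 0 <= y n) -> (exists n, y n != 0) ->
  (\sum_(n <oo) (n%:R * y n)%:E < +oo)%E -> 0 < succ_moment y.
Proof.
move=> y0 [n yn] yoo; have oo := succ_moment_lty y y0 yoo.
have y0' i : (0 <= (i.+1%:R * y i)%:E)%E by rewrite lee_fin mulr_ge0.
rewrite /succ_moment fine_gt0// oo andbT.
have : (\sum_(0 <= i < n.+1) (i.+1%:R * y i)%:E <= \sum_(i <oo) (i.+1%:R * y i)%:E)%E.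
  exact: nneseries_lim_ge.
apply: lt_le_trans; rewrite sumEFin lte_fin big_nat_recr//= ltr_wpDl//.
  by apply: sumr_ge0 => k _; rewrite mulr_ge0.
by rewrite mulr_gt0// lt0r yn y0.
Qed.

End series.

(** * Asymptotics of the normalizing constant *)

Section partition_function.
Context {R : realType} (sigma : R).
Hypothesis sigma0 : 0 < sigma.
Local Notation tm := (tm sigma).
Local Notation d L := (tm L 0 0).
Local Notation kappa := ((2 + sigma) / sigma).

Let d_gt0 L : 0 < d L.
Proof. exact: tm00_gt0. Qed.

Let kappa_ge0 : 0 <= kappa.
Proof. by rewrite divr_ge0 ?addr_ge0 ?ltW. Qed.

Lemma tm_ratio_le L n m : 0 <= tm L n m / d L <= kappa * (n.+1%:R * m.+1%:R).
Proof.
rewrite divr_ge0 ?tm_ge0//= ler_pdivrMr//.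
by rewrite -(mulrA kappa); exact: tm_le.
Qed.

Lemma iter_transfer_series (y : nat -> R) L n : (forall n, 0 <= y n) ->
  iter L (transfer sigma) y n / d L = fine (\sum_(m <oo) (tm L n m / d L * y m)%:E)%E.
Proof.
move=> y0.
have t0 m : 0 <= tm L n m / d L * y m.
  by rewrite mulr_ge0//; have /andP[] := tm_ratio_le L n m.
rewrite nneseries_esumT; last by move=> m; rewrite lee_fin.
rewrite (@esum_bounded_support _ _ (n + L).+1)//=; last first.
  by move=> m nm; rewrite tm_small// !mul0r.
rewrite (@iter_transfer _ _ _ _ _ (n + L).+1)// mulr_suml.
by apply: eq_bigr => i _; rewrite mulrAC.
Qed.

Lemma scaled_moment (y : nat -> R) (c : R) : 0 < c -> (forall n, 0 <= y n) ->
  fine (\sum_(m <oo) (c * (m.+1%:R * y m))%:E)%E = c * succ_moment y.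
Proof.
move=> c0 y0; rewrite /succ_moment -fine_mull// -nneseriesZl//.
by move=> m _; rewrite lee_fin mulr_ge0.
Qed.

Lemma scaled_moment_lty (y : nat -> R) (c : R) : 0 <= c -> (forall n, 0 <= y n) ->
  (\sum_(n <oo) (n%:R * y n)%:E < +oo)%E ->
  (\sum_(m <oo) (c * (m.+1%:R * y m))%:E < +oo)%E.
Proof.
move=> c0 y0 yoo.
rewrite (_ : (\sum_(m <oo) _)%E = (c%:E * \sum_(m <oo) (m.+1%:R * y m)%:E)%E).
  by rewrite lte_mul_pinfty// succ_moment_lty.
by rewrite -nneseriesZl// => m _; rewrite lee_fin mulr_ge0.
Qed.

Variable y : nat -> R.
Hypothesis y0 : forall n, 0 <= y n.
Hypothesis yoo : (\sum_(n <oo) (n%:R * y n)%:E < +oo)%E.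

Lemma tm_ratio_mul_le L n m :
  0 <= tm L n m / d L * y m <= kappa * n.+1%:R * (m.+1%:R * y m).
Proof.
have /andP[h1 h2] := tm_ratio_le L n m; rewrite mulr_ge0//=.
by rewrite mulrA ler_wpM2r// -mulrA.
Qed.

Lemma cvg_iter_transfer n :
  iter L (transfer sigma) y n / d L @[L --> \oo] --> n.+1%:R * succ_moment y.
Proof.
under eq_fun do rewrite iter_transfer_series//.
rewrite -scaled_moment//.
apply: (@cvg_nneseries_dominated _ (fun L m => tm L n m / d L * y m)
  (fun m => kappa * n.+1%:R * (m.+1%:R * y m))).
- by move=> L m; exact: tm_ratio_mul_le.
- by apply: scaled_moment_lty => //; rewrite mulr_ge0.
- move=> m; rewrite mulrA; apply: cvgM; last exact: cvg_cst.
  exact: cvg_tm.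
Qed.

(** Uniformity in [L] is what dominates the sum over the starting point in [cvg_Cnorm]. *)
Lemma iter_transfer_le L n : iter L (transfer sigma) y n / d L <=
  kappa * n.+1%:R * succ_moment y.
Proof.
have k0 : 0 < kappa * n.+1%:R :> R by rewrite mulr_gt0// divr_gt0// addr_gt0.
have goo := scaled_moment_lty y _ (ltW k0) y0 yoo.
rewrite iter_transfer_series// -scaled_moment// fine_le//.
- exact: nneseries_fin_num (tm_ratio_mul_le L n) goo.
- apply: nneseries_fin_num goo => m; rewrite lexx andbT.
  by apply: mulr_ge0; [exact: ltW|exact: mulr_ge0].
- apply: lee_nneseries => [m _ _|m _]; rewrite lee_fin;
  by case/andP: (tm_ratio_mul_le L n m).
Qed.

Lemma iter_transfer_ge0 L n : 0 <= iter L (transfer sigma) y n.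
Proof.
by elim: L n => [|L IH] n //=; apply: transfer_ge0 => //; exact: ltW.
Qed.

Variable x : nat -> R.
Hypothesis x0 : forall n, 0 <= x n.
Hypothesis xoo : (\sum_(n <oo) (n%:R * x n)%:E < +oo)%E.

Lemma CnormE L : Cnorm sigma x y L =
  (\sum_(n <oo) (x n * iter L (transfer sigma) y n)%:E)%E.
Proof.
rewrite nneseries_esumT; last by move=> n; rewrite lee_fin mulr_ge0// iter_transfer_ge0.
rewrite /Cnorm (_ : motzkin L = admissible L (fun _ _ => true)); last first.
  by apply/seteqP; split => g //= [].
rewrite esum_admissible//; last exact: ltW.
apply: eq_esum => n _; rewrite -[in constrained _ _ _](addn0 L).
rewrite constrained_free// (_ : constrained _ 0 _ y = y)//.
by apply/funext => k; rewrite /= mul1r.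
Qed.

Lemma cvg_Cnorm : fine (Cnorm sigma x y L) / d L @[L --> \oo] -->
  succ_moment x * succ_moment y.
Proof.
have sy0 : 0 <= succ_moment y.
  by apply/fine_ge0/nneseries_ge0 => m _ _; rewrite lee_fin mulr_ge0.
rewrite (_ : (fun _ => _) = fun L =>
    fine (\sum_(n <oo) (x n * (iter L (transfer sigma) y n / d L))%:E)%E); last first.
  apply/funext => L; rewrite mulrC -fine_mull ?invr_gt0// CnormE -nneseriesZl; last first.
    by move=> n _; rewrite lee_fin mulr_ge0// iter_transfer_ge0.
  by congr fine; apply: eq_eseriesr => n _; congr EFin; ring.
rewrite (_ : succ_moment x * succ_moment y =
    fine (\sum_(n <oo) (x n * (n.+1%:R * succ_moment y))%:E)%E); last first.
  (* [scaled_moment] asks for a positive factor, so a vanishing moment of [y] is treated apart. *)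
  move: sy0; rewrite le_eqVlt => /predU1P[<-|sy0].
    rewrite mulr0 eseries0// => n _ _; by rewrite !mulr0.
  rewrite mulrC -scaled_moment//; congr fine.
  by apply: eq_eseriesr => n _; congr EFin; ring.
apply: (@cvg_nneseries_dominated _ (fun L n => x n * (iter L (transfer sigma) y n / d L))
  (fun n => kappa * succ_moment y * (n.+1%:R * x n))).
- move=> L n; apply/andP; split.
    by rewrite mulr_ge0// divr_ge0 ?iter_transfer_ge0// ltW.
  apply: le_trans (ler_wpM2l (x0 n) (iter_transfer_le L n)) _.
  by rewrite le_eqVlt; apply/orP; left; apply/eqP; ring.
- by apply: scaled_moment_lty => //; apply: mulr_ge0.
- by move=> n; apply: cvgM; [exact: cvg_cst|exact: cvg_iter_transfer].
Qed.

End partition_function.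

(** * Cylinder probabilities and their limit *)

Lemma pval_rev L (g : path_t L) k : (k <= L)%N -> rpval L g k = pval L g (L - k).
Proof. by move=> kL; rewrite /rpval /pval kL leq_subr. Qed.

Lemma PrL_cylinder {R : realType} (sigma : R) (x y : nat -> R) K M (a b : nat -> nat) :
  0 < sigma -> (forall n, 0 <= x n) -> (forall n, 0 <= y n) ->
  PrL sigma x y (K + (M.+1 + K)) [set g | forall k, (k <= K)%N ->
      pval (K + (M.+1 + K)) g k = a k /\ rpval (K + (M.+1 + K)) g k = b k] =
  x (a 0) * (\prod_(k < K) step sigma (a k) (a k.+1) *
    \prod_(k < K) step sigma (b k) (b k.+1) * tm sigma M.+1 (a K) (b K) * y (b 0)) /
  fine (Cnorm sigma x y (K + (M.+1 + K))).
Proof.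
move=> s0 x0 y0; set L := (K + _)%N; rewrite /PrL; congr (_ / _).
(* At this length the two blocks of prescribed sites are disjoint, so at most one of the two
   implications binds at each site. *)
pose c k n := ((k <= K)%N ==> (n == a k)) && ((L - k <= K)%N ==> (n == b (L - k)%N)).
rewrite (_ : _ `&` _ = admissible L c); last first.
  apply/seteqP; split => g /= [mg H]; split=> // k kK.
    apply/andP; split; apply/implyP => kK'; first by have [-> _] := H k kK'.
    have [_] := H _ kK'; rewrite pval_rev ?leq_subr// subKn// => ->; exact: eqxx.
  have kL : (k <= L)%N by rewrite /L; lia.
  split; first by have /andP[/implyP/(_ kK)/eqP] := H k kL.
  rewrite pval_rev//; have /andP[_ /implyP] := H (L - k)%N (leq_subr _ _).
  by rewrite subKn// => /(_ kK)/eqP.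
rewrite esum_admissible//; last exact: ltW.
have C0 n : 0 <= constrained sigma L c y n by apply: constrained_ge0; first exact: ltW.
rewrite (_ : (\esum_(n in [set: nat]) _)%E = (x (a 0) * constrained sigma L c y (a 0))%:E).
  congr (_ * _); rewrite /= (@constrained_bridge _ _ K M c y a b)//.
  - move=> k n kK; rewrite /c kK /=; case: (boolP (L - k <= K)%N); last by rewrite andbT.
    by rewrite /L; lia.
  - by move=> k n kM; rewrite /c /L; apply/andP; split; apply/implyP; lia.
  - move=> k n kK; rewrite /c (_ : (K + M.+1 + k <= K)%N = false) /=; last by lia.
    by rewrite (_ : L - (K + M.+1 + k) = K - k)%N ?leq_subr// /L; lia.
rewrite esum_mkcond.
rewrite (eq_esum (b := fun n => if n \in [set a 0%N] then
    (x n * constrained sigma L c y n)%:E else 0%E)).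
  rewrite -esum_mkcond esum_set1// lee_fin; exact: mulr_ge0.
move=> n _; rewrite mem_set//; case: ifPn => // /negP na.
rewrite constrained_eq0 ?mulr0//; apply/negP => /andP[/implyP/(_ isT)/eqP n0 _].
by apply: na; rewrite inE.
Qed.

(** Doob transform: [trans] is [T] conjugated by its eigenfunction [n + 1] and divided by
    [2 + sigma]. The quotients telescope, and the denominator left at [a 0] cancels against the
    initial law. *)
Lemma mc_fddE {R : realType} (sigma : R) (y : nat -> R) K (a : nat -> nat) :
  0 < sigma -> mc_fdd (init_law y) (trans sigma) K a =
  y (a 0) / succ_moment y * (\prod_(k < K) step sigma (a k) (a k.+1) *
    ((a K).+1%:R * (2 + sigma) ^- K)).
Proof.
move=> s0; have r0 : 2 + sigma != 0 by rewrite gt_eqF// addr_gt0.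
have nz n : n.+1%:R != 0 :> R by rewrite pnatr_eq0.
rewrite /mc_fdd /init_law -/(succ_moment y).
suff -> : \prod_(k < K) trans sigma (a k) (a k.+1) =
    (\prod_(k < K) step sigma (a k) (a k.+1)) *
    ((a K).+1%:R * (2 + sigma) ^- K) / (a 0).+1%:R.
  move: (nz (a 0%N)) (succ_moment y)^-1 (\prod_(_ < _) _ * _).
  by move: (_.+1%:R) => p p0 v t; field.
elim: K => [|K IH].
  by rewrite !big_ord0 expr0 invr1 mulr1 mul1r divff.
rewrite !big_ord_recr /= IH exprS.
have -> : trans sigma (a K) (a K.+1) =
    step sigma (a K) (a K.+1) * ((a K.+1).+1%:R / (a K).+1%:R / (2 + sigma)).
  rewrite /trans /step; move: (a K) (a K.+1) => n m.
  case: eqP => [->|nm].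
    by rewrite leqnn leqW// ltn_eqF// mul1r expr0 mul1r mulrC.
  case: eqP => [->|mn].
    by rewrite leqnSn eqxx mul1r expr1 divff ?mul1r// pnatr_eq0.
  case: eqP => [<-|mn'].
    by rewrite leqnn leqW// gtn_eqF// mul1r expr0 mul1r mulrC.
  rewrite (_ : (_ && _) = false) ?mul0r//; lia.
move: (nz (a K)) (nz (a 0%N)) (expf_neq0 K r0) (r0).
move: ((2 + sigma) ^+ K) => r; move: (2 + sigma) => t; move: (a 0%N).+1%:R => q.
move: (a K).+1%:R => p p0 q0 rn0 t0.
by field; rewrite p0 q0 rn0 t0.
Qed.

Theorem theorem1p1 (R : realType) (sigma : R) (alpha beta : nat -> R) :
  0 < sigma ->
  (forall n, 0 <= alpha n) -> (forall n, 0 <= beta n) ->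
  (exists n, alpha n != 0) -> (exists n, beta n != 0) ->
  (\sum_(n <oo) (n%:R * alpha n)%:E < +oo)%E ->
  (\sum_(n <oo) (n%:R * beta n)%:E < +oo)%E ->
  forall (K : nat) (a b : nat -> nat),
    (fun L : nat =>
       PrL sigma alpha beta L
         [set g : path_t L | forall k : nat, (k <= K)%N ->
                               pval L g k = a k /\ rpval L g k = b k])
      @ \oo -->
    mc_fdd (init_law alpha) (trans sigma) K a *
    mc_fdd (init_law beta) (trans sigma) K b.
Proof.
move=> s0 a0 b0 an0 bn0 aoo boo K a b.
have Ca := succ_moment_gt0 alpha a0 an0 aoo.
have Cb := succ_moment_gt0 beta b0 bn0 boo.
(* Lengths become [M + (2K + 1)], leaving [M + 1] free steps between the blocks. *)
rewrite -(cvg_shiftn (K + K).+1) /=.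
pose d L := tm sigma L 0 0.
have d0 L : d L != 0 by rewrite gt_eqF// tm00_gt0.
pose Sa := \prod_(k < K) step sigma (a k) (a k.+1).
pose Sb := \prod_(k < K) step sigma (b k) (b k.+1).
(* Numerator and denominator are divided by the return weight of the full length; [num] passes
   through that of the free length [M + 1]. *)
pose num M := alpha (a 0) * (Sa * Sb *
  (tm sigma M.+1 (a K) (b K) / d M.+1 * (d M.+1 / d (M.+1 + (K + K))%N)) * beta (b 0)).
pose den M := fine (Cnorm sigma alpha beta (M + (K + K).+1)) / d (M + (K + K).+1)%N.
rewrite (_ : (fun _ => _) = fun M => num M * (den M)^-1); last first.
  apply/funext => M; rewrite /num /den.
  have -> : (M + (K + K).+1 = K + (M.+1 + K))%N by lia.
  rewrite PrL_cylinder// (_ : M.+1 + (K + K) = K + (M.+1 + K))%N; last by lia.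
  rewrite -/Sa -/Sb invf_div.
  have := d0 (K + (M.+1 + K))%N; have := d0 M.+1.
  move: (fine _)^-1 (d (K + _)%N) (d _) => v p q q0 p0.
  by field; rewrite p0 q0.
rewrite !mc_fddE//.
(* Independence appears here: the limit of the bridge weight is a product of a factor in [a K] and
   one in [b K], and the power of [2 + sigma] splits evenly. *)
rewrite (_ : alpha (a 0%N) / succ_moment alpha * _ * _ = alpha (a 0%N) * (Sa * Sb *
    ((a K).+1%:R * (b K).+1%:R * (2 + sigma) ^- (K + K)) * beta (b 0)) *
    (succ_moment alpha * succ_moment beta)^-1); last first.
  rewrite exprD -/Sa -/Sb; field.
  by rewrite !gt_eqF ?exprn_gt0 ?addr_gt0.
apply: cvgM; last first.
  apply: cvgV; first by rewrite mulf_neq0// gt_eqF.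
  by rewrite (cvg_shiftn _ (fun L => fine (Cnorm sigma alpha beta L) / d L)); exact: cvg_Cnorm.
apply: cvgM; first exact: cvg_cst.
apply: cvgM; last exact: cvg_cst.
apply: cvgM; first exact: cvg_cst.
apply: cvgM.
  by rewrite (cvg_shiftS (fun L => tm sigma L (a K) (b K) / d L)); exact: cvg_tm.
by rewrite (cvg_shiftS (fun L => d L / d (L + (K + K))%N)); exact: cvg_tm00_shift.
Qed.
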